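(* Let $K=\mathbb{F}_q$ be a finite field, let $S=K[t_1,\ldots,t_s]$, let $X$ be a set of points of $\mathbb{A}^s=K^s$, let $\mathcal{L}_X$ be an evaluation code on $X$ (where $\mathcal{L}$ is a finite-dimensional $K$-linear subspace of $S$), and let $\prec$ be a monomial order on $S$. Then there is a standard evaluation code $\widetilde{\mathcal{L}}_X$ on $X$ relative to $\prec$ such that $\widetilde{\mathcal{L}}_X=\mathcal{L}_X$.
   Context: Write $X=\{P_1,\ldots,P_m\}$ (distinct points). The evaluation map is ${\rm ev}\colon S\to K^m$, $f\mapsto(f(P_1),\ldots,f(P_m))$. For a finite-dimensional $K$-linear subspace $\mathcal{L}\subset S$, the evaluation code $\mathcal{L}_X$ is ${\rm ev}(\mathcal{L})$. Let $I=I(X)$ be the ideal of polynomials vanishing at all points of $X$, and let $\Delta_\prec(I)$ be the set of standard monomials of $S/I$, i.e. monomials not in the initial ideal ${\rm in}_\prec(I)$. The code $\mathcal{L}_X$ is called a standard evaluation code on $X$ relative to $\prec$ if $\mathcal{L}$ is a linear subspace of $K\Delta_\prec(I)$, the $K$-span of $\Delta_\prec(I)$. *)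

(* Defs.v *)
From mathcomp Require Import all_boot all_order all_algebra.
From mathcomp Require Import mpoly.
From mathcomp Require Import boolp classical_sets.

Set Implicit Arguments.
Unset Strict Implicit.
Unset Printing Implicit Defensive.

Import GRing.Theory.

Local Open Scope classical_set_scope.
Local Open Scope ring_scope.

Section LinearAlgebra.
Variables (K : fieldType) (V : lmodType K).

Definition lspan (A : set V) : set V :=
  [set v | exists n (c : 'I_n -> K) (u : 'I_n -> V),
     (forall i, A (u i)) /\ v = \sum_(i < n) c i *: u i].

Definition fin_dim_subspace (L : set V) : Prop :=
  GRing.submod_closed (mem L) /\ exists b : seq V, L = lspan [set` b].

End LinearAlgebra.

Definition ideal_gen (R : comNzRingType) (G : set R) : set R :=
  [set f | exists n (c g : 'I_n -> R),
     (forall i, G (g i)) /\ f = \sum_(i < n) c i * g i].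

(* [le m1 m2] is the non-strict order; together with compatibility, the
   minimality of the monomial 1 (exponent 0%MM) makes it a well-order. *)
Definition monomial_order (s : nat) (le : rel 'X_{1..s}) : Prop :=
  [/\ total le, antisymmetric le, transitive le,
      forall m : 'X_{1..s}, le 0%MM m &
      forall m1 m2 m : 'X_{1..s}, le m1 m2 -> le (m1 + m)%MM (m2 + m)%MM].

Section StandardMonomials.
Variables (K : fieldType) (s : nat) (le : rel 'X_{1..s}).

(* No [m] is initial for [f = 0]. *)
Definition initial_monomial (f : {mpoly K[s]}) (m : 'X_{1..s}) : Prop :=
  m \in msupp f /\ {in msupp f, forall m' : 'X_{1..s}, le m' m}.

Definition initial_ideal (I : set {mpoly K[s]}) : set {mpoly K[s]} :=
  ideal_gen [set g | exists f m,
    [/\ I f, initial_monomial f m & g = 'X_[m]]].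

Definition standard_monomials (I : set {mpoly K[s]}) : set {mpoly K[s]} :=
  [set g | exists2 m : 'X_{1..s}, g = 'X_[m] & ~ initial_ideal I 'X_[m]].

End StandardMonomials.

Section EvaluationCodes.
Variables (K : finFieldType) (s : nat).

Definition vanishing_ideal (X : {set 'rV[K]_s}) : set {mpoly K[s]} :=
  [set f | forall x, x \in X -> f.@[fun i => x 0 i] = 0].

Definition ev (m : nat) (P : m.-tuple 'rV[K]_s) (f : {mpoly K[s]}) : 'rV[K]_m :=
  \row_(j < m) f.@[fun i => tnth P j 0 i].

Definition eval_code (m : nat) (P : m.-tuple 'rV[K]_s)
    (L : set {mpoly K[s]}) : set 'rV[K]_m := ev P @` L.

(* The code [eval_code P L] is standard on X when [L] is a standard space. *)
Definition standard_space (le : rel 'X_{1..s}) (X : {set 'rV[K]_s})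
    (L : set {mpoly K[s]}) : Prop :=
  fin_dim_subspace L /\
  L `<=` lspan (standard_monomials le (vanishing_ideal X)).

End EvaluationCodes.

(* Main.v *)
(** Because x^q = x on K, every monomial agrees on X with a monomial that is not
    larger for the order and has all exponents below q.  There are finitely many
    of these, so one can divide by I(X) by induction on them, without Dickson's
    lemma: a monomial of the initial ideal is the leading monomial of some f in
    I(X), hence agrees on X with a combination of strictly smaller monomials.
    Every polynomial thus agrees on X with an element of K Delta(I); do this to
    generators of L. *)
From HB Require Import structures.
Require Import Defs.
From mathcomp Require Import all_boot all_order all_algebra.
From mathcomp Require Import finfield.
From mathcomp Require Import mpoly.
From mathcomp Require Import boolp classical_sets.

Set Implicit Arguments.
Unset Strict Implicit.
Unset Printing Implicit Defensive.

Import GRing.Theory.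

Local Open Scope classical_set_scope.
Local Open Scope ring_scope.

Section LinearSpans.
Variables (K : fieldType) (V : lmodType K).
Implicit Types A B : set V.

Lemma submod_closedP A :
  GRing.submod_closed (mem A) <->
  A 0 /\ forall a u v, A u -> A v -> A (a *: u + v).
Proof.
split=> -[A0 Alin]; split.
- by rewrite -in_setE.
- move=> a u v Au Av; rewrite -in_setE; apply: (Alin a u v); exact/mem_set.
- exact/mem_set.
- by move=> a u v /set_mem Au /set_mem Av; apply/mem_set/Alin.
Qed.

Lemma submod_closed_sum A (I : eqType) (r : seq I) (c : I -> K) (u : I -> V) :
  GRing.submod_closed (mem A) -> (forall i, i \in r -> A (u i)) ->
  A (\sum_(i <- r) c i *: u i).
Proof.
move=> /submod_closedP[A0 Alin] Au; rewrite big_seq.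
apply: big_rec => // i x ir Ax; apply: Alin => //; exact: Au.
Qed.

Lemma lspan_incl A : A `<=` lspan A.
Proof.
move=> v Av; exists 1%N, (fun=> 1), (fun=> v); split=> //.
by rewrite big_ord1 scale1r.
Qed.

Lemma lspan_submod A : GRing.submod_closed (mem (lspan A)).
Proof.
apply/submod_closedP; split.
  exists 0%N, (fun=> 0), (fun=> 0); split=> [[]//|]; by rewrite big_ord0.
move=> a _ _ [n [c [u [Au ->]]]] [p [d [w [Aw ->]]]].
exists (n + p)%N,
  (fun i => match split i with inl j => a * c j | inr j => d j end),
  (fun i => match split i with inl j => u j | inr j => w j end).
split=> [i|]; first by case: (split i).
rewrite big_split_ord scaler_sumr; congr (_ + _); apply: eq_bigr => i _.
  by rewrite (unsplitK (inl i)) scalerA.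
by rewrite (unsplitK (inr i)).
Qed.

Lemma lspan_min A B :
  GRing.submod_closed (mem B) -> A `<=` B -> lspan A `<=` B.
Proof.
move=> Bsub AB _ [n [c [u [Au ->]]]].
by apply: submod_closed_sum => // i _; apply: AB.
Qed.

(** Reduces the comparison of two codes to the images of generators. *)
Lemma image_lspan (W : lmodType K) (f : {linear V -> W}) A :
  f @` lspan A = lspan (f @` A).
Proof.
apply/seteqP; split.
  move=> _ [_ [n [c [u [Au ->]]]] <-].
  exists n, c, (f \o u); split=> [i|]; first by exists (u i).
  by rewrite linear_sum; apply: eq_bigr => i _; rewrite linearZ.
move=> _ [n [c [w [Aw ->]]]].
have /choice[u uP] : forall i, exists v, A v /\ f v = w i.
  by move=> i; have [v Av fv] := Aw i; exists v.
exists (\sum_(i < n) c i *: u i).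
  by exists n, c, u; split=> // i; case: (uP i).
by rewrite linear_sum; apply: eq_bigr => i _; rewrite linearZ (uP i).2.
Qed.

End LinearSpans.

Section Evaluation.
Variables (K : finFieldType) (s m : nat) (P : m.-tuple 'rV[K]_s).

Lemma ev_is_linear : linear (ev P).
Proof. by move=> a f g; apply/rowP=> j; rewrite !mxE mevalD mevalZ. Qed.

HB.instance Definition _ :=
  GRing.isLinear.Build K {mpoly K[s]} 'rV[K]_m _ (ev P) ev_is_linear.

End Evaluation.

Section Division.
Variables (K : finFieldType) (s : nat) (X : {set 'rV[K]_s}).
Variables (le : rel 'X_{1..s}) (le_mon : monomial_order le).

Local Notation I := (vanishing_ideal X).
Local Notation standard_span := (lspan (standard_monomials le I)).

Lemma vanishing_ideal_submod : GRing.submod_closed (mem I).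
Proof.
apply/submod_closedP; split=> [x _|a f g fI gI x xX]; first by rewrite meval0.
by rewrite mevalD mevalZ fI ?gI// mulr0 addr0.
Qed.

Lemma le_addl (m k : 'X_{1..s}) : le m (k + m)%MM.
Proof.
by case: le_mon => _ _ _ le0 leD; rewrite -[X in le X _]add0m; apply: leD.
Qed.

(** Induction on the degree: if t_i^q divides the monomial, replace this factor by t_i, which takes
    the same values on K. *)
Lemma monomial_exponents_lt (m : 'X_{1..s}) : exists m' : 'X_{1..s},
  [/\ forall i, (m' i < #|K|)%N, le m' m & I ('X_[m] - 'X_[m'])].
Proof.
have [tot _ le_tr _ _] := le_mon.
have [n] := ubnP (mdeg m); elim: n m => // n IHn m /ltnSE mn.
have [i qm|mq] := pickP (fun i => #|K| <= m i)%N; last first.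
  exists m; split=> [i||x _]; first by rewrite ltnNge mq.
    by have := tot m m; rewrite orbb.
  by rewrite mevalB subrr.
have q1 : (1 < #|K|)%N := finNzRing_gt1 K.
pose k := (m - U_(i) *+ #|K|)%MM.
have mE : m = (U_(i) *+ #|K| + k)%MM.
  rewrite addmC submK//; apply/mnm_lepP => j.
  by rewrite mulmnE mnm1E; case: eqP => [<-|_]; rewrite ?mul1n ?mul0n.
(* The old monomial is t_i^(q-1) times the new one, so the new one is not larger for [le], and its
   degree is smaller since q > 1. *)
have m1E : m = (U_(i) *+ #|K|.-1 + (U_(i) + k))%MM.
  by rewrite addmA [(_ *+ _ + U_(i))%MM]addmC -mulmS prednK// ltnW.
have [|m' [m'q m'm m'I]] := IHn (U_(i) + k)%MM.
  apply: leq_trans mn; rewrite m1E (mdegD (U_(i) *+ _)%MM) mdegMn mdeg1 mul1n.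
  by rewrite -[X in (X < _)%N]add0n ltn_add2r -subn1 subn_gt0.
exists m'; split=> //.
  by apply: le_tr m'm _; rewrite [X in le _ X]m1E le_addl.
move=> x xX; have := m'I x xX; rewrite !mevalB => <-; congr (_ - _).
by rewrite mE !mpolyXD !mevalM -mpolyXn rmorphXn/= expf_card.
Qed.

(** Some term c_i g_i must contain the monomial m, so m is a multiple of the monomial g_i, which is
    initial for some f in I(X). Multiplying f by the quotient monomial makes m initial, as [le] is
    compatible with products. *)
Lemma initial_ideal_monomial (m : 'X_{1..s}) :
  initial_ideal le I 'X_[m] -> exists2 f, I f & initial_monomial le f m.
Proof.
case: le_mon => _ _ _ _ leD [n [c [g [gI Xm]]]].
have [i cgm] : exists i, (c i * g i)@_m != 0.
  apply/existsP; apply: contraT; rewrite negb_exists => /forallP c0.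
  have := mcoeffX K m m; rewrite Xm raddf_sum/= big1 => [/esym/eqP|i _].
    by rewrite eqxx oner_eq0.
  by have := c0 i; rewrite negbK => /eqP.
have [f [k [fI [kf fk] gE]]] := gI i.
move: cgm; rewrite gE -mcoeff_msupp (perm_mem (msuppMX _ _)) => /mapP[d _ ->].
exists (f * 'X_[d]) => [x xX|]; first by rewrite mevalM fI// mul0r.
split; first by rewrite mcoeff_msupp addmC mcoeffMX -mcoeff_msupp.
move=> m'; rewrite (perm_mem (msuppMX _ _)) => /mapP[j jf ->].
by rewrite addmC; apply/leD/fk.
Qed.

(** The subspace K Delta(I) + I(X), to be shown equal to the whole ring. *)
Definition reducible : set {mpoly K[s]} :=
  [set f | exists2 g, standard_span g & I (f - g)].

Lemma reducible_submod : GRing.submod_closed (mem reducible).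
Proof.
have /submod_closedP[S0 Slin] := lspan_submod (standard_monomials le I).
have /submod_closedP[I0 Ilin] := vanishing_ideal_submod.
apply/submod_closedP; split; first by exists 0; rewrite ?subr0.
move=> a f g [f' f'S ff'] [g' g'S gg']; exists (a *: f' + g'); first exact: Slin.
by rewrite opprD addrACA -scalerBr; apply: Ilin.
Qed.

Lemma reducible_congr f g : I (f - g) -> reducible g -> reducible f.
Proof.
have /submod_closedP[_ Ilin] := vanishing_ideal_submod.
move=> fg [h hS gh]; exists h => //.
by rewrite -(subrKA g) -[f - g]scale1r; apply: Ilin.
Qed.

Lemma reducible_leading (m : 'X_{1..s}) :
  (forall m', le m' m -> m' != m -> reducible 'X_[m']) -> reducible 'X_[m].
Proof.
move=> IHm; have [/initial_ideal_monomial[f fI [mf fm]]|mS] :=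
  pselect (initial_ideal le I 'X_[m]); last first.
  exists 'X_[m]; first by apply: lspan_incl; exists m.
  by move=> x _; rewrite mevalB subrr.
have fm0 : f@_m != 0 by rewrite -mcoeff_msupp.
(* Scaling f to leading coefficient 1 cancels m, so only monomials strictly below m survive in h. *)
pose h := 'X_[m] - (f@_m)^-1 *: f.
apply: (@reducible_congr _ h).
  by move=> x xX; rewrite opprB addrCA subrr addr0 mevalZ fI ?mulr0.
rewrite [h]mpolyE; apply: submod_closed_sum reducible_submod _ => m'.
rewrite mcoeff_msupp mcoeffB mcoeffZ mcoeffX => hm'.
have m'm : m' != m.
  by apply: contraNneq hm' => ->; rewrite eqxx mulVf// subrr.
apply: IHm => //; apply: fm; rewrite mcoeff_msupp.
by apply: contraNneq hm' => ->; rewrite [m == _]eq_sym (negbTE m'm) mulr0 subr0.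
Qed.

Lemma reducible_monomial (m : 'X_{1..s}) : reducible 'X_[m].
Proof.
have [_ le_anti le_tr _ _] := le_mon.
have [k [kq _ mk]] := monomial_exponents_lt m; apply: reducible_congr mk _.
(* The degree bound places all monomials with exponents below q in a finite type, so that those
   below a given one can be counted. *)
have small (l : 'X_{1..s}) :
    (forall i, (l i < #|K|)%N) -> (mdeg l < (s * #|K|).+1)%N.
  move=> lq; rewrite ltnS mdegE -[s in (s * _)%N]card_ord -sum_nat_const.
  by apply: leq_sum => i _; apply: ltnW.
pose below l := [set b : 'X_{1..s < (s * #|K|).+1} |
  le b l && (b != l :> 'X_{1..s})]%SET.
have [n] := ubnP #|below k|; elim: n k kq => // n IHn k kq /ltnSE kn.
apply: reducible_leading => m' m'k m'neq.
(* The degree of m' may exceed the bound; its replacement l is within it and still strictly below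
   k. *)
have [l [lq lm' m'l]] := monomial_exponents_lt m'.
apply: reducible_congr m'l _; apply: IHn => //; apply: leq_trans kn.
have lk : le l k by apply: le_tr lm' m'k.
have lneq : l != k.
  apply: contraNneq m'neq => lE; apply/eqP/le_anti.
  by rewrite m'k -[X in le X _]lE.
(* The count drops because l itself is counted below k but not below l. *)
apply/proper_card/properP; split.
  apply/fintype.subsetP => b; rewrite !inE => /andP[bl bneq].
  rewrite (le_tr _ _ _ bl lk)/=; apply: contraNneq bneq => bE.
  by apply/eqP/le_anti; rewrite bl bE.
exists (BMultinom (small l lq)); rewrite !inE /= ?lk ?lneq//.
by rewrite eqxx andbF.
Qed.

Lemma reducible_mpoly f : reducible f.
Proof.
rewrite [f]mpolyE; apply: submod_closed_sum reducible_submod _ => m _.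
exact: reducible_monomial.
Qed.

End Division.

Theorem proposition3p5 (K : finFieldType) (s m : nat) (X : {set 'rV[K]_s})
    (P : m.-tuple 'rV[K]_s) (P_uniq : uniq P) (P_enum : P =i X)
    (L : set {mpoly K[s]}) (L_fin : fin_dim_subspace L)
    (le : rel 'X_{1..s}) (le_mon : monomial_order le) :
  exists L' : set {mpoly K[s]},
    standard_space le X L' /\ eval_code P L' = eval_code P L.
Proof.
case: L_fin => _ [b ->].
(* The choice [nf] need not be linear: it is applied only to the generators [b], and linearity of
   [ev] does the rest. *)
have /choice[nf nfP] : forall f, exists g,
    lspan (standard_monomials le (vanishing_ideal X)) g /\
    vanishing_ideal X (f - g).
  by move=> f; have [g] := reducible_mpoly X le_mon f; exists g.
have ev_nf f : ev P (nf f) = ev P f.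
  apply/rowP => j; rewrite !mxE; apply/esym/eqP; rewrite -subr_eq0 -mevalB.
  by apply/eqP; apply: (nfP f).2; rewrite -P_enum mem_tnth.
exists (lspan [set` map nf b]); split.
  split; first by split; [exact: lspan_submod | exists (map nf b)].
  apply: lspan_min (@lspan_submod _ _ _) _ => _ /= /mapP[f _ ->].
  exact: (nfP f).1.
rewrite /eval_code !image_lspan; congr lspan; apply/seteqP; split.
  by move=> _ [_ /= /mapP[f fb ->] <-]; exists f.
by move=> _ [f fb <-]; exists (nf f); [exact: map_f | exact: ev_nf].
Qed.
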